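(* Let $k$, $\ell$, and $n$ be non-negative integers with $k\neq 0$. Then the $k$-Pell number $P_{k,\ell n}$ can be represented by the integral $$P_{k,\ell n}=\frac{nP_{k,\ell}}{2^n}\int_{-1}^{1}\left(Q_{k,\ell}+2\sqrt{1+k}\,P_{k,\ell}\, x\right)^{n-1}dx.$$
   Context: For a positive integer $k$, the $k$-Pell numbers $P_{k,n}$ ($n\ge 0$) are defined by $P_{k,0}=0$, $P_{k,1}=1$ and $P_{k,n}=2P_{k,n-1}+kP_{k,n-2}$ for $n\ge 2$. The $k$-Pell-Lucas numbers $Q_{k,n}$ ($n\ge 0$) are defined by $Q_{k,0}=2$, $Q_{k,1}=2$ and $Q_{k,n}=2Q_{k,n-1}+kQ_{k,n-2}$ for $n\ge 2$. Convention: when $n=0$, the right-hand side of the claimed identity is read as $0$ because of the factor $n$. *)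

(* Defs.v *)
From Stdlib Require Import Arith.

Fixpoint pell (k n : nat) : nat :=
  match n with
  | 0 => 0
  | S m => match m with
           | 0 => 1
           | S p => 2 * pell k m + k * pell k p
           end
  end.

Fixpoint pell_lucas (k n : nat) : nat :=
  match n with
  | 0 => 2
  | S m => match m with
           | 0 => 2
           | S p => 2 * pell_lucas k m + k * pell_lucas k p
           end
  end.

(* Main.v *)
Require Import Defs.
From Stdlib Require Import Reals.
From Coquelicot Require Import Coquelicot.
From Stdlib Require Import Lra Lia.
Open Scope R_scope.

(** Put [s = sqrt (1 + k)]. The characteristic roots of the common recurrence
    are [1 + s] and [1 - s], and Binet's formulas ([pell_binet],
    [pell_lucas_binet]) read [2 s P_l = (1+s)^l - (1-s)^l] and
    [Q_l = (1+s)^l + (1-s)^l]. Hence the affine function [Q_l + 2 s P_l x] takes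
    the values [2 (1+s)^l] at [x = 1] and [2 (1-s)^l] at [x = -1]. Since
    [n a (q + a x)^(n-1)] is the derivative of [(q + a x)^n]
    ([RInt_affine_pow]), integrating with [a = 2 s P_l] gives
    [2^n ((1+s)^(l n) - (1-s)^(l n))], which is [2^n * 2 s P_(l n)] by Binet
    again. Cancelling [2^n] and the factor [2 s], which is nonzero, yields the
    identity; the slope [a] itself is never divided by, so the degenerate case
    [P_l = 0] is covered as well. *)

(** The two-step recurrence forces the induction to carry two consecutive
    indices; the step uses that [1 + s] and [1 - s] are the roots of
    [z^2 = 2 z + k]. *)
Lemma pell_binet (k n : nat) (s : R) (hs : s * s = 1 + INR k) :
  2 * s * INR (pell k n) = (1 + s) ^ n - (1 - s) ^ n.
Proof.
  enough (H : 2 * s * INR (pell k n) = (1 + s) ^ n - (1 - s) ^ n /\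
              2 * s * INR (pell k (S n)) = (1 + s) ^ S n - (1 - s) ^ S n)
    by apply H.
  assert (hk : INR k = s * s - 1) by lra.
  induction n as [|n [IH0 IH1]].
  - simpl; split; ring.
  - split; [exact IH1|].
    change (pell k (S (S n))) with (2 * pell k (S n) + k * pell k n)%nat.
    rewrite plus_INR, !mult_INR, hk.
    replace (2 * s * (INR 2 * INR (pell k (S n)) + (s * s - 1) * INR (pell k n)))
      with (2 * (2 * s * INR (pell k (S n)))
            + (s * s - 1) * (2 * s * INR (pell k n))) by (simpl; ring).
    rewrite IH0, IH1; simpl; ring.
Qed.

Lemma pell_lucas_binet (k n : nat) (s : R) (hs : s * s = 1 + INR k) :
  INR (pell_lucas k n) = (1 + s) ^ n + (1 - s) ^ n.
Proof.
  enough (H : INR (pell_lucas k n) = (1 + s) ^ n + (1 - s) ^ n /\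
              INR (pell_lucas k (S n)) = (1 + s) ^ S n + (1 - s) ^ S n)
    by apply H.
  assert (hk : INR k = s * s - 1) by lra.
  induction n as [|n [IH0 IH1]].
  - simpl; split; ring.
  - split; [exact IH1|].
    change (pell_lucas k (S (S n)))
      with (2 * pell_lucas k (S n) + k * pell_lucas k n)%nat.
    rewrite plus_INR, !mult_INR, hk, IH0, IH1; simpl; ring.
Qed.

(** The factor [a] stays on the left so that the formula also holds for a
    constant integrand. *)
Lemma RInt_affine_pow (q a u v : R) (n : nat) :
  INR n * a * RInt (fun x => (q + a * x) ^ (n - 1)) u v =
    (q + a * v) ^ n - (q + a * u) ^ n.
Proof.
  assert (cont : forall x, continuous (fun x => (q + a * x) ^ (n - 1)) x)
    by (intro x; apply (ex_derive_continuous (V := R_NormedModule));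
        auto_derive; exact I).
  transitivity (RInt (fun x => scal (INR n * a) ((q + a * x) ^ (n - 1))) u v).
  { symmetry; apply (RInt_scal (V := R_CompleteNormedModule)).
    apply (ex_RInt_continuous (V := R_CompleteNormedModule)).
    intros x _; apply cont. }
  apply is_RInt_unique.
  apply (is_RInt_derive (V := R_CompleteNormedModule) (fun x => (q + a * x) ^ n)).
  - intros x _; auto_derive; [exact I|].
    unfold scal; simpl; unfold mult; simpl.
    replace (Init.Nat.pred n) with (n - 1)%nat by lia; ring.
  - intros x _; apply (continuous_scal_r (V := R_NormedModule)), cont.
Qed.

(* Stdlib reals.  For n = 0 the truncated exponent n - 1 is 0; the right-hand
   side is then 0 because of the factor INR n. *)
Theorem theorem3p1 (k l n : nat) (hk : k <> 0%nat) :
  INR (pell k (l * n)) =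
    INR n * INR (pell k l) / 2 ^ n *
    RInt (fun x : R =>
            (INR (pell_lucas k l)
             + 2 * sqrt (1 + INR k) * INR (pell k l) * x) ^ (n - 1)) (-1) 1.
Proof.
  pose proof (pos_INR k) as k_ge0.
  assert (s_gt0 : 0 < sqrt (1 + INR k)) by (apply sqrt_lt_R0; lra).
  assert (hs : sqrt (1 + INR k) * sqrt (1 + INR k) = 1 + INR k)
    by (apply sqrt_sqrt; lra).
  set (s := sqrt (1 + INR k)) in *.
  pose proof (pell_binet k l s hs) as Pl.
  pose proof (pell_lucas_binet k l s hs) as Ql.
  pose proof (pell_binet k (l * n) s hs) as Pln.
  pose proof (RInt_affine_pow (INR (pell_lucas k l)) (2 * s * INR (pell k l))
                (-1) 1 n) as HI.
  set (I := RInt _ _ _) in *.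
  replace (INR (pell_lucas k l) + 2 * s * INR (pell k l) * 1)
    with (2 * (1 + s) ^ l) in HI by lra.
  replace (INR (pell_lucas k l) + 2 * s * INR (pell k l) * -1)
    with (2 * (1 - s) ^ l) in HI by lra.
  rewrite !Rpow_mult_distr, <- !pow_mult in HI.
  assert (pow2 : 2 ^ n <> 0) by (apply pow_nonzero; lra).
  apply (Rmult_eq_reg_l (2 ^ n * (2 * s)));
    [|apply Rmult_integral_contrapositive_currified; lra].
  transitivity (INR n * (2 * s * INR (pell k l)) * I); [|field; exact pow2].
  rewrite HI, Rmult_assoc, Pln; ring.
Qed.
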